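(* There is a deterministic algorithm for graph verification using a distance oracle whose query complexity is $$n^{1+O\left(\sqrt{(\log\log n+\log\Delta)/\log n}\right)},$$ where $\Delta$ is the maximum degree of the given graph $\hat G$ (this is $n^{1+o(1)}$ when $\Delta=n^{o(1)}$). Moreover, if $\hat G$ has treewidth $\mathrm{tw}$, the query complexity of the same algorithm is $O(\Delta(\Delta+\mathrm{tw}\log n)\,n\log^2 n)$.
   Context: Let $G=(V,E)$ be an unknown connected, unweighted, undirected simple graph with $|V|=n$, and let $\delta$ be its shortest-path metric. A distance oracle receives a pair $(u,v)\in V^2$ and returns $\delta(u,v)$. In the verification problem, an algorithm is given $V$ and a connected graph $\hat G=(V,\hat E)$, has access to the distance oracle for $G$, and must decide whether $G=\hat G$ (i.e., whether $E=\hat E$). The query complexity is the maximum number of oracle queries made. *)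

(* Defs.v *)
From Stdlib Require Import Reals.
From HB Require Import structures.
From mathcomp Require Import all_boot.

Set Implicit Arguments.
Unset Strict Implicit.
Unset Printing Implicit Defensive.

Definition simple_graph n (e : rel 'I_n) : Prop :=
  symmetric e /\ irreflexive e.

Definition connected_graph n (e : rel 'I_n) : Prop :=
  forall u v, connect e u v.

Definition walkb n (e : rel 'I_n) (k : nat) (u v : 'I_n) : bool :=
  [exists p : k.-tuple 'I_n, path e u p && (last u p == v)].

(* Shortest-path distance: least k such that a u-v walk of length k exists.
   In a connected graph on n vertices this is < n; (for disconnected pairs
   the value n is returned, but only connected graphs are ever used). *)
Definition sp_dist n (e : rel 'I_n) (u v : 'I_n) : nat :=
  find (fun k => walkb e k u v) (iota 0 n).

(* Deterministic adaptive query algorithms = decision trees: each internal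
   node queries the oracle on a pair (u,v) and branches on the answer. *)
Inductive qtree (T : Type) : Type :=
| Leaf of bool
| Ask of T & T & (nat -> qtree T).

Fixpoint run (T : Type) (o : T -> T -> nat) (t : qtree T) : bool * nat :=
  match t with
  | Leaf b => (b, 0)
  | Ask u v k => let r := run o (k (o u v)) in (r.1, r.2.+1)
  end.

Definition max_degree n (e : rel 'I_n) : nat :=
  \max_(v : 'I_n) #|[set u | e v u]|.

Definition is_tree m (te : rel 'I_m) : Prop :=
  simple_graph te /\ connected_graph te /\
  ~ (exists c : seq 'I_m, 2 < size c /\ ucycle te c).

Definition tree_decomposition n (e : rel 'I_n) m (te : rel 'I_m)
    (B : 'I_m -> {set 'I_n}) : Prop :=
  [/\ is_tree te,
      (forall v, exists t, v \in B t),
      (forall u v, e u v -> exists t, (u \in B t) && (v \in B t)) &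
      (forall v t1 t2, v \in B t1 -> v \in B t2 ->
         connect [rel x y | [&& te x y, v \in B x & v \in B y]] t1 t2)].

Definition decomp_width n m (B : 'I_m -> {set 'I_n}) : nat :=
  (\max_(t : 'I_m) #|B t|).-1.

Definition has_treewidth n (e : rel 'I_n) (tw : nat) : Prop :=
  (exists m (te : rel 'I_m) (B : 'I_m -> {set 'I_n}),
      tree_decomposition e te B /\ decomp_width B = tw) /\
  (forall m (te : rel 'I_m) (B : 'I_m -> {set 'I_n}),
      tree_decomposition e te B -> (tw <= decomp_width B)%N).

(* Main.v *)
(** The algorithm queries all edges of the given graph [eh], plus a smallest
    set [T] of further pairs, and accepts iff every answer agrees with [eh].
    Once the edges of [eh] are known to be edges of [e], distances in [e] are at
    most those in [eh], so an answer [sp_dist e a b = sp_dist eh a b] excludes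
    every edge [uv] that would create a shortcut from [a] to [b]; [T] is chosen
    so that all non-edges of [eh] are excluded in this way. It remains to bound
    the size of some valid [T], by recursion on the set [U] of vertices whose
    non-edges are to be excluded. Querying [w] against [U] excludes all pairs of
    [U] whose distances to [w] differ by at least 2.

    - Treewidth: query the closed neighbourhood of a bag that is a balanced
      separator for [U]. If a shortest path from [u] to [v] meets the bag at [b],
      moving [b] one step towards the nearer of the two (if needed) makes the
      distances differ by 2, so only pairs in one component survive.
    - In general: Thorup-Zwick centers [A], about [s log n] of them, have the
      property that each cluster [{v in U | d w v < d A v}] has size at most
      [|U|/s]. Querying the radius-2 ball around [A] leaves only pairs lying in a
      common region of size about [Delta^2 |U|/s]. Taking [s ~ Delta^2 r] with
      [r ~ n^(1/k)] and [k ~ sqrt (log n / (loglog n + log Delta))] gives the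
      subpolynomial overhead. *)
Require Import Defs.
From Stdlib Require Import Reals Lra ZArith.
From HB Require Import structures.
From mathcomp Require Import all_boot.
From mathcomp Require Import zify.

Set Implicit Arguments.
Unset Strict Implicit.
Unset Printing Implicit Defensive.

Lemma card_bigcup_le (I T : finType) (P : pred I) (F : I -> {set T}) :
  #|\bigcup_(i | P i) F i| <= \sum_(i | P i) #|F i|.
Proof.
elim/big_rec2: _ => [|i a A _ le]; first by rewrite cards0.
by apply: leq_trans (leq_card_setU _ _) _; rewrite leq_add2l.
Qed.

(** * Shortest-path distance *)

Section Distance.
Variables (n : nat) (e : rel 'I_n).
Hypothesis (es : simple_graph e) (ec : connected_graph e).
Local Notation d := (sp_dist e).

Lemma walkbP k u v :
  reflect (exists p : seq 'I_n, [/\ path e u p, last u p = v & size p = k])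
          (walkb e k u v).
Proof.
apply: (iffP existsP) => [[p /andP[pp /eqP lp]]|[p [pp lp /eqP sp]]].
  by exists p; rewrite size_tuple.
by exists (Tuple sp); rewrite /= pp lp eqxx.
Qed.

Lemma sp_dist_le p u v : path e u p -> last u p = v -> d u v <= size p.
Proof.
move=> pp lp; have w : walkb e (size p) u v by apply/walkbP; exists p.
case: (ltnP (size p) n) => [ltn|le].
  rewrite leqNgt; apply/negP => /(before_find 0).
  by rewrite nth_iota // add0n w.
(* The search never returns more than [n], its default value. *)
by apply: leq_trans le; rewrite -[X in _ <= X](size_iota 0) find_size.
Qed.

(** A shortened walk repeats no vertex, hence has length below [n]: in a connected graph the default
    value is never returned. *)
Lemma sp_dist_walk u v :
  exists p : seq 'I_n, [/\ path e u p, last u p = v & size p = d u v].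
Proof.
apply/walkbP; have /connectP[p0 pp0 lp0] := ec u v.
case: (shortenP pp0) lp0 => p pp up _ lp0.
have sn : size p < n.
  by have := max_card (mem (u :: p)); rewrite (card_uniqP up) card_ord.
have h : has (fun k => walkb e k u v) (iota 0 n).
  by apply/hasP; exists (size p); [rewrite mem_iota | apply/walkbP; exists p].
have := nth_find 0 h; rewrite nth_iota //.
by rewrite has_find size_iota in h.
Qed.

Lemma sp_dist_sym u v : d u v = d v u.
Proof.
suff le u1 v1 : d u1 v1 <= d v1 u1 by apply/eqP; rewrite eqn_leq !le.
have [p [pp <- <-]] := sp_dist_walk v1 u1.
rewrite -[size p](size_belast v1) -size_rev; apply: sp_dist_le.
  by rewrite rev_path (eq_path (e' := e)) // => x y /=; rewrite (proj1 es).
by case: p pp => //= x p _; rewrite rev_cons last_rcons.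
Qed.

Lemma sp_dist_triangle w u v : d u v <= d u w + d w v.
Proof.
have [p [pp lp <-]] := sp_dist_walk u w; have [q [pq lq <-]] := sp_dist_walk w v.
by rewrite -size_cat; apply: sp_dist_le; rewrite ?cat_path ?last_cat lp // pp.
Qed.

Lemma sp_dist0 u : d u u = 0.
Proof. by apply/eqP; rewrite -leqn0 (@sp_dist_le [::]). Qed.

Lemma sp_dist_edge u v : e u v = (d u v == 1).
Proof.
apply/idP/eqP => [euv|d1]; last first.
  have := sp_dist_walk u v; rewrite d1 => -[[|x [|? ?]] [] //=].
  by case/andP=> h _ <-.
have := @sp_dist_le [:: v] u v; rewrite /= euv => /(_ isT erefl).
case dd: (d u v) => [|[|]] // _.
have := sp_dist_walk u v; rewrite dd => -[[|? ?] [] //= _ eq].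
by rewrite eq (proj2 es) in euv.
Qed.

Lemma sp_dist_split i u v : i <= d u v ->
  exists w, d u w = i /\ d w v = d u v - i.
Proof.
move=> le; have [p [pp lp sp]] := sp_dist_walk u v.
have pq := pp; rewrite -(cat_take_drop i p) cat_path in pq.
case/andP: pq => p1 p2; exists (last u (take i p)).
have l1 : d u (last u (take i p)) <= i.
  by apply: leq_trans (sp_dist_le p1 erefl) _; rewrite size_take_min geq_minl.
have l2 : d (last u (take i p)) v <= d u v - i.
  by rewrite -sp -size_drop; apply: sp_dist_le p2 _; rewrite -last_cat cat_take_drop.
have := sp_dist_triangle (last u (take i p)) u v; lia.
Qed.

End Distance.

(** * Covering the non-edges by queries *)

Section Cover.
Variables (n : nat) (e : rel 'I_n).
Local Notation d := (sp_dist e).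

(* A truthful answer [d p.1 p.2] rules out [uv] as an edge, because either of
   its two orientations would shorten the path. *)
Definition confirms (p : 'I_n * 'I_n) u v :=
  (d p.1 u + d v p.2 + 1 < d p.1 p.2) || (d p.1 v + d u p.2 + 1 < d p.1 p.2).

Definition covers (U : {set 'I_n}) (T : {set 'I_n * 'I_n}) :=
  [forall u in U, forall v in U, (1 < d u v) ==> [exists p in T, confirms p u v]].

(** Taking a minimum makes the choice independent of any construction: exhibiting any cover bounds
    its size, so one algorithm meets both bounds. *)
Definition opt_cover (U : {set 'I_n}) : {set 'I_n * 'I_n} :=
  [arg min_(T < setT | covers U T) #|T|].

Definition cost U := #|opt_cover U|.

Definition ball1 (X : {set 'I_n}) := [set y | [exists x in X, d x y <= 1]].

Hypotheses (es : simple_graph e) (ec : connected_graph e).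

Lemma coversP (U : {set 'I_n}) (T : {set 'I_n * 'I_n}) :
  reflect (forall u v, u \in U -> v \in U -> 1 < d u v ->
             exists2 p, p \in T & confirms p u v) (covers U T).
Proof.
apply: (iffP forall_inP) => [h u v uU vU duv|h u uU].
  by have /forall_inP/(_ v vU)/implyP/(_ duv)/exists_inP := h u uU.
apply/forall_inP => v vU; apply/implyP => duv; apply/exists_inP; exact: h.
Qed.

Lemma confirms_endpoints u v : 1 < d u v -> confirms (u, v) u v.
Proof. by rewrite /confirms /= !sp_dist0 // => ->. Qed.

Lemma covers_opt U : covers U (opt_cover U).
Proof.
rewrite /opt_cover; case: arg_minnP => //.
by apply/coversP => u v _ _ duv; exists (u, v); rewrite ?inE ?confirms_endpoints.
Qed.

Lemma cost_le U T : covers U T -> cost U <= #|T|.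
Proof.
rewrite /cost /opt_cover; case: arg_minnP => [|T0 _ h /h //].
by apply/coversP => u v _ _ duv; exists (u, v); rewrite ?inE ?confirms_endpoints.
Qed.

Lemma cost_square U : cost U <= #|U| * #|U|.
Proof.
rewrite -cardsX; apply: cost_le; apply/coversP => u v uU vU duv.
by exists (u, v); rewrite ?inE ?uU // confirms_endpoints.
Qed.

(** One level of either recursion: querying [X] against [U] settles each pair whose distances to
    some [w] in [X] differ by at least 2; the other pairs are left to optimal covers of the sets
    [F i]. *)
Lemma cost_split (I : finType) (P : pred I) (F : I -> {set 'I_n}) (U X : {set 'I_n}) :
    (forall u v, u \in U -> v \in U -> 1 < d u v ->
       (forall w, w \in X -> d w u <= (d w v).+1 /\ d w v <= (d w u).+1) ->
       exists2 i, P i & (u \in F i) && (v \in F i)) ->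
  cost U <= #|X| * #|U| + \sum_(i | P i) cost (F i).
Proof.
move=> h; pose T := setX X U :|: \bigcup_(i | P i) opt_cover (F i).
apply: (@leq_trans #|T|); last first.
  apply: leq_trans (leq_card_setU _ _) _.
  by rewrite cardsX leq_add2l card_bigcup_le.
apply: cost_le; apply/coversP => u v uU vU duv.
have [/exists_inP[p pX cp]|] := boolP [exists p in setX X U, confirms p u v].
  by exists p => //; rewrite inE pX.
rewrite negb_exists_in => /forall_inP nc.
have [w wX|i Pi /andP[uF vF]] := h u v uU vU duv.
  have := nc (w, v); have := nc (w, u).
  by rewrite !inE /confirms /= wX uU vU !sp_dist0 // => /(_ isT) + /(_ isT); lia.
have /coversP/(_ u v uF vF duv)[p pT cp] := covers_opt (F i).
by exists p => //; rewrite inE; apply/orP; right; apply/bigcupP; exists i.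
Qed.

Lemma sub_ball1 (X : {set 'I_n}) : X \subset ball1 X.
Proof.
by apply/subsetP => x xX; rewrite inE; apply/exists_inP; exists x; rewrite ?sp_dist0.
Qed.

Lemma card_ball1 (X : {set 'I_n}) : #|ball1 X| <= #|X| * (max_degree e).+1.
Proof.
have sub : ball1 X \subset \bigcup_(x in X) (x |: [set y | e x y]).
  apply/subsetP => y; rewrite inE => /exists_inP[x xX le].
  apply/bigcupP; exists x => //; rewrite !inE (sp_dist_edge es ec).
  have [_|d1] := eqVneq (d x y) 1; first by rewrite orbT.
  have d0 : d x y = 0 by lia.
  have := sp_dist_walk ec x y; rewrite d0 => -[[|? ?] [] //= _ -> _].
  by rewrite eqxx.
apply: leq_trans (subset_leq_card sub) _.
rewrite -sum_nat_const; apply: leq_trans (card_bigcup_le _ _) _.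
apply: leq_sum => x _.
apply: leq_trans (leq_card_setU _ _) _; rewrite cards1 ltnS.
exact: (leq_bigmax (F := fun v => #|[set u | e v u]|)).
Qed.

Definition ball2 (X : {set 'I_n}) := ball1 (ball1 X).

Lemma mem_ball2 (X : {set 'I_n}) x y : x \in X -> d x y <= 2 -> y \in ball2 X.
Proof.
move=> xX le2.
have [|m [mx my]] := @sp_dist_split _ e ec (minn 1 (d x y)) x y; first by lia.
rewrite inE; apply/exists_inP; exists m; last by lia.
by rewrite inE; apply/exists_inP; exists x => //; lia.
Qed.

Lemma card_ball2 (X : {set 'I_n}) : #|ball2 X| <= #|X| * (max_degree e).+1 ^ 2.
Proof.
apply: leq_trans (card_ball1 _) _; rewrite expnS expn1 mulnA leq_mul2r.
by rewrite card_ball1 orbT.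
Qed.

End Cover.

(** Of [(w, x)] and [(x, w)] at most one is counted. *)
Lemma sum_ltn_pairs (T : finType) (B : {set T}) (f : T -> nat) :
  2 * (\sum_(x in B) #|[set w in B | f w < f x]|) <= #|B| ^ 2.
Proof.
have card1 g : \sum_(x in B) #|[set w in B | g w x]| =
               \sum_(x in B) \sum_(w in B) (g w x : bool).
  by apply: eq_bigr => x _; rewrite -sum1dep_card big_mkcondr; apply: eq_bigr.
rewrite card1 mul2n -addnn {2}exchange_big /= -big_split /=.
have -> : #|B| ^ 2 = \sum_(x in B) \sum_(w in B) 1.
  by rewrite sum_nat_const sum1_card.
apply: leq_sum => x _; rewrite -big_split /=; apply: leq_sum => w _.
by case: ltngtP.
Qed.

(** Bernoulli's inequality. With [a + 1 = 2s] it says that [2s] rounds of decay by the factor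
    [1 - 1/(2s)] at least halve a quantity. *)
Lemma double_exp_leq a : 2 * a ^ a.+1 <= a.+1 ^ a.+1.
Proof.
have bernoulli k : a ^ k.+1 + k.+1 * a ^ k <= a.+1 ^ k.+1.
  elim: k => [|k IH]; first by rewrite !expn1 expn0; lia.
  rewrite !expnS in IH *.
  have := leq_mul (leqnn a.+1) IH; move: (a ^ k) (a.+1 ^ k) => X Y; nia.
apply: leq_trans (bernoulli a); rewrite mul2n -addnn leq_add2l expnS.
by rewrite leq_mul2r leqnSn orbT.
Qed.

(** * Centers with small clusters *)

Section Centers.
Variables (n : nat) (e : rel 'I_n) (U : {set 'I_n}) (s : nat).
Local Notation d := (sp_dist e).

Definition cluster (A : {set 'I_n}) w :=
  [set v in U | [forall a in A, d w v < d a v]].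

Definition large (A : {set 'I_n}) := [set w | #|U| < #|cluster A w| * s].

(** Large clusters are nonempty, so this vanishes exactly when there are none. *)
Definition potential (A : {set 'I_n}) := \sum_(w in large A) #|cluster A w|.

(** The Thorup-Zwick dual of the clusters; double counting passes from one to the other. *)
Definition bunch (W A : {set 'I_n}) v := [set w in W | v \in cluster A w].

Lemma cluster_add A x w : cluster (x |: A) w \subset cluster A w.
Proof.
apply/subsetP => v; rewrite !inE => /andP[-> /forall_inP h] /=.
by apply/forall_inP => a aA; apply: h; rewrite !inE aA orbT.
Qed.

Lemma sum_cluster (W A : {set 'I_n}) :
  \sum_(w in W) #|cluster A w| =
  \sum_(v in U) #|bunch W A v|.
Proof.
transitivity (\sum_(w in W) \sum_(v in U) (v \in cluster A w : nat)).
  apply: eq_bigr => w _; rewrite -sum1_card big_mkcond [RHS]big_mkcond /=.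
  by apply: eq_bigr => v _; rewrite inE; case: (v \in U); case: forall_inP.
rewrite exchange_big /=; apply: eq_bigr => v _.
by rewrite -sum1dep_card big_mkcondr; apply: eq_bigr => w _; case: (v \in _).
Qed.

(* A center [x] outside the bunch of [v] does no harm; one inside keeps only the
   vertices strictly closer to [v] than [x], on average less than half. *)
Lemma sum_bunch_add (W A : {set 'I_n}) v : v \in U ->
  \sum_(x in W) 2 * #|bunch W (x |: A) v| + #|bunch W A v| ^ 2
    <= 2 * #|W| * #|bunch W A v|.
Proof.
move=> vU; pose b A' := #|bunch W A' v|; set B := bunch W A v.
have BW : B \subset W by apply/subsetP => w; rewrite inE => /andP[].
have out : \sum_(x in W :\: B) 2 * b (x |: A) <= #|W :\: B| * (2 * b A).
  rewrite -sum_nat_const; apply: leq_sum => x _; rewrite leq_mul2l /=.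
  apply: subset_leq_card; apply/subsetP => w; rewrite !inE => /andP[-> /=].
  case/andP=> -> /forall_inP h; apply/forall_inP => a aA; apply: h.
  by rewrite !inE aA orbT.
have ins : \sum_(x in B) 2 * b (x |: A) <= b A ^ 2.
  rewrite -big_distrr /=; apply: leq_trans (sum_ltn_pairs B (fun w => d w v)).
  rewrite leq_mul2l /=; apply: leq_sum => x xB; apply: subset_leq_card.
  apply/subsetP => w; rewrite !inE => /andP[-> /= /andP[-> /forall_inP h]].
  rewrite h ?setU11 // andbT; apply/forall_inP => a aA.
  by apply: h; rewrite !inE aA orbT.
rewrite (big_setID B) /= (setIidPr BW).
move: ins out; rewrite cardsD (setIidPr BW) -!/(b _).
have := subset_leq_card BW; rewrite -/(b A).
move: (\sum_(x in B) _) (\sum_(x in _ :\: _) _) => X Y h1 h2 h3.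
have -> : 2 * #|W| * b A = (#|W| - b A) * (2 * b A) + 2 * b A ^ 2 by nia.
lia.
Qed.

Hypothesis s0 : 0 < s.

(* An average [x] among the centers of large clusters works: by Cauchy-Schwarz,
   used in the linearized form [2 (s b) m <= (s b)^2 + m^2], the bunches lose
   a fraction [1/(2s)] of their total size. *)
Lemma potential_step (A : {set 'I_n}) : large A != set0 ->
  exists x, 2 * s * potential (x |: A) <= (2 * s).-1 * potential A.
Proof.
move=> Wn0; pose W := large A; pose m := #|W|.
pose Phi A' := \sum_(w in W) #|cluster A' w|.
(* Adding a center creates no new large cluster, so the sum may be taken over the fixed set [W]. *)
have pot x : potential (x |: A) <= Phi (x |: A).
  rewrite /potential /Phi [X in _ <= X](big_setID (large (x |: A))) /=.
  rewrite (setIidPr _) ?leq_addr //; apply/subsetP => w; rewrite !inE => lt.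
  apply: leq_trans lt _; rewrite leq_mul2r subset_leq_card ?orbT //.
  exact: cluster_add.
suff [x xW le] : exists2 x, x \in W & 2 * s * Phi (x |: A) <= (2 * s).-1 * Phi A.
  exists x; apply: leq_trans le; rewrite leq_mul2l pot orbT //.
apply/exists_inP/negbNE; rewrite negb_exists_in; apply/negP => /forall_inP lt.
pose b A' v := #|bunch W A' v|.
have sumb A' : Phi A' = \sum_(v in U) b A' v by rewrite /Phi sum_cluster.
have le1 : \sum_(x in W) 2 * Phi (x |: A) + \sum_(v in U) b A v ^ 2
           <= 2 * m * Phi A.
  rewrite sumb big_distrr /=.
  under eq_bigr do rewrite sumb big_distrr /=.
  rewrite exchange_big /= -big_split /=; apply: leq_sum => v vU.
  exact: sum_bunch_add.
have le2 : 2 * s * m * Phi A <= s ^ 2 * (\sum_(v in U) b A v ^ 2) + m ^ 2 * #|U|.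
  rewrite sumb !big_distrr /= (mulnC (m ^ 2)) -sum_nat_const -big_split /=.
  apply: leq_sum => v _; have := (nat_Cauchy (s * b A v) m).1; rewrite expnMn; lia.
have le3 : m * #|U| <= s * Phi A.
  rewrite /m -sum_nat_const /Phi big_distrr /=; apply: leq_sum => w.
  by rewrite inE mulnC => /ltnW.
have le4 : m * ((2 * s).-1 * Phi A).+1 <= s * \sum_(x in W) 2 * Phi (x |: A).
  rewrite /m -sum_nat_const [X in _ <= X]big_distrr /=; apply: leq_sum => x xW.
  by have := lt x xW; rewrite -ltnNge mulnA (mulnC s).
have m0 : 0 < m by rewrite card_gt0.
move: le1 le2 le3 le4; move: (\sum_(x in W) _) (\sum_(v in U) _) (Phi A) => X Y F.
move=> le1 le2 le3 le4.
(* [le3], which holds because clusters over [W] are large, absorbs the term [m ^ 2 * #|U|] of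
   [le2]. *)
have le5 : m * F <= s * Y by rewrite -(leq_pmul2l s0); nia.
have le6 : s * (X + Y) <= s * (2 * m * F) by rewrite leq_mul2l le1 orbT.
have [q sq] : exists q, 2 * s = q.+1 by exists (2 * s).-1; lia.
have eq : s * (2 * m * F) = m * F * (2 * s) by lia.
by move: le4 le6; rewrite eq sq /=; lia.
Qed.

Lemma potential_iter k : exists2 A : {set 'I_n},
  #|A| <= k & (2 * s) ^ k * potential A <= (2 * s).-1 ^ k * n ^ 2.
Proof.
elim: k => [|k [A cA le]].
  exists set0; first by rewrite cards0.
  rewrite !expn0 !mul1n; apply: (@leq_trans (\sum_(w : 'I_n) n)).
    rewrite /potential big_mkcond; apply: leq_sum => w _; case: ifP => // _.
    by rewrite -[X in _ <= X]card_ord max_card.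
  by rewrite sum_nat_const card_ord.
have [W0|/potential_step[x lex]] := eqVneq (large A) set0.
  by exists A; [exact: leqW | rewrite /potential W0 big_set0 muln0].
exists (x |: A).
  apply: leq_trans (leq_card_setU _ _) _; rewrite cards1; lia.
rewrite (expnS (2 * s)) (expnS (2 * s).-1).
have h1 : (2 * s) ^ k * (2 * s * potential (x |: A))
          <= (2 * s) ^ k * ((2 * s).-1 * potential A).
  by rewrite leq_mul2l lex orbT.
have h2 : (2 * s).-1 * ((2 * s) ^ k * potential A)
          <= (2 * s).-1 * ((2 * s).-1 ^ k * n ^ 2).
  by rewrite leq_mul2l le orbT.
move: h1 h2; move: (2 * s).-1 => q; move: (2 * s) => t.
move: (q ^ k) (t ^ k) (n ^ 2) (potential A) (potential _) => a b c p p'; lia.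
Qed.

(** After [4sL] rounds the potential is at most [n^2 (1 - 1/(2s))^(4sL) <= n^2 / 4^L < 1], so it is
    zero. *)
Lemma exists_centers L : n < 2 ^ L ->
  exists2 A : {set 'I_n}, #|A| <= 4 * s * L &
    forall w, #|cluster A w| * s <= #|U|.
Proof.
move=> nL; have [A cA] := potential_iter (2 * s * (2 * L)).
rewrite !(expnM _ (2 * s)) => le; exists A; first by lia.
suff p0 : potential A = 0.
  move=> w; rewrite leqNgt; apply/negP => lt.
  have wl : w \in large A by rewrite inE.
  move: p0; rewrite /potential (bigD1 w) //= => /eqP.
  by rewrite addn_eq0 => /andP[/eqP z _]; rewrite z in lt.
pose a := (2 * s).-1; have a1 : 2 * s = a.+1 by rewrite /a; lia.
move: le; rewrite -[in (2 * s).-1]/a !a1 /=; move: (potential A) => P le.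
have a0 : 0 < a by lia.
have h : 2 ^ (2 * L) * (a ^ a.+1) ^ (2 * L) <= (a.+1 ^ a.+1) ^ (2 * L).
  rewrite -expnMn; case: (posnP (2 * L)) => [->|p]; first by rewrite !expn0.
    by rewrite leq_exp2r ?double_exp_leq.
apply/eqP; rewrite -leqn0 -ltnS -(@ltn_pmul2l ((a ^ a.+1) ^ (2 * L) * 2 ^ (2 * L))).
  apply: (@leq_ltn_trans ((a ^ a.+1) ^ (2 * L) * n ^ 2)).
    by apply: leq_trans le; rewrite leq_mul2r mulnC h orbT.
  by rewrite muln1 ltn_pmul2l ?expn_gt0 ?a0 // mulnC expnM ltn_exp2r.
by rewrite muln_gt0 !expn_gt0 a0.
Qed.

End Centers.

(** * Recursion through centers *)

Section GeneralCost.
Variables (n : nat) (e : rel 'I_n).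
Local Notation d := (sp_dist e).
Hypotheses (es : simple_graph e) (ec : connected_graph e).
Local Notation M := ((max_degree e).+1 ^ 2).

(** The first part serves pairs with an endpoint within 1 of [a], the second the other pairs
    assigned to [a]. *)
Definition region (U A : {set 'I_n}) a :=
  (U :&: ball2 e [set a]) :|: \bigcup_(b in ball2 e [set a]) cluster e U A b.

Lemma card_region (U A : {set 'I_n}) s a :
    (forall w, #|cluster e U A w| * s <= #|U|) ->
  #|region U A a| * s <= M * s + M * #|U|.
Proof.
move=> h; have cb : #|ball2 e [set a]| <= M.
  by have := card_ball2 es ec [set a]; rewrite cards1 mul1n.
apply: (@leq_trans (#|ball2 e [set a]| * s + #|ball2 e [set a]| * #|U|)); last first.
  by rewrite leq_add // leq_mul2r cb orbT.
apply: leq_trans (leq_mul (leq_card_setU _ _) (leqnn s)) _.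
rewrite mulnDl leq_add //.
  by rewrite leq_mul2r subset_leq_card ?subsetIr ?orbT.
rewrite -[X in _ <= X]sum_nat_const.
apply: leq_trans (leq_mul (card_bigcup_le _ _) (leqnn s)) _.
by rewrite big_distrl; apply: leq_sum.
Qed.

(* Let [a] be the center nearest to [{u, v}]. Two steps from [a] towards the
   nearer endpoint lead to a vertex whose cluster contains both: one step
   compensates for the difference of the distances, one gives strictness. *)
Lemma region_cover (U A : {set 'I_n}) u v : u \in U -> v \in U -> A != set0 ->
    (forall w, w \in ball2 e A -> d w u <= (d w v).+1 /\ d w v <= (d w u).+1) ->
  exists2 a, a \in A & (u \in region U A a) && (v \in region U A a).
Proof.
move=> uU vU /set0Pn[a0 a0A] near.
have [a aA amin] : exists2 a, a \in A & forall a', a' \in A ->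
    minn (d a u) (d a v) <= minn (d a' u) (d a' v).
  by case: (arg_minnP (fun a => minn (d a u) (d a v)) a0A) => a; exists a.
exists a => //; wlog le : u v uU vU near amin / d a u <= d a v.
  move=> wl; have [/wl->//|/ltnW le] := leqP (d a u) (d a v).
  rewrite andbC; apply: wl => // [w wA|a' a'A]; first by have [] := near w wA.
  by have := amin a' a'A; rewrite minnC (minnC (d a' u)).
have ball2A b : b \in ball2 e [set a] -> b \in ball2 e A.
  rewrite !inE => /exists_inP[x xa le1]; apply/exists_inP; exists x => //.
  move: xa; rewrite !inE => /exists_inP[y]; rewrite inE => /eqP-> le2.
  by apply/exists_inP; exists a.
(* If [d a u <= 1], then [near] at [a] gives [d a v <= 2], and both endpoints lie in the ball. *)
have [au1|au2] := leqP (d a u) 1.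
  have [|_ av] := near a.
    by apply: (mem_ball2 ec aA); rewrite sp_dist0.
  by rewrite /region !in_setU !in_setI uU vU !(mem_ball2 ec (set11 a)) //; lia.
have [b [ab bu]] := sp_dist_split ec au2.
have ba : b \in ball2 e [set a] by apply: (mem_ball2 ec (set11 a)); rewrite ab.
have [_ bv] := near b (ball2A b ba).
have mem x : x \in U -> (forall a', a' \in A -> d b x < d a' x) -> x \in region U A a.
  move=> xU lt; rewrite inE; apply/orP; right; apply/bigcupP; exists b => //.
  by rewrite inE xU; apply/forall_inP.
by apply/andP; split; apply: mem => // a' /amin; lia.
Qed.

Lemma cost_step s L (U : {set 'I_n}) : 1 < s -> n < 2 ^ L ->
  exists (A : {set 'I_n}) (F : 'I_n -> {set 'I_n}),
    [/\ #|A| <= 4 * s * L,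
        forall a, #|F a| * s <= M * s + M * #|U| &
        cost e U <= #|A| * M * #|U| + \sum_(a in A) cost e (F a)].
Proof.
move=> s1 nL; have [A cA clA] := exists_centers e U (ltnW s1) nL.
exists A, (region U A); split=> // [a|]; first exact: card_region.
apply: leq_trans (cost_split (P := fun a => a \in A) (F := region U A)
                             (X := ball2 e A) _) _.
  move=> u v uU vU _ near; apply: region_cover => //.
  (* Without centers the cluster of [u] would be all of [U], too large for [s > 1]. *)
  apply: contraTneq s1 => A0; have := clA u.
  have -> : cluster e U A u = U.
    apply/setP => x; rewrite inE A0; case: (x \in U) => //=.
    by apply/forall_inP => y; rewrite inE.
  have : 0 < #|U| by rewrite card_gt0; apply/set0Pn; exists u.
  by move=> *; nia.
by rewrite leq_add2r leq_mul2r card_ball2 ?orbT.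
Qed.

(** Induction on [k] with [s = 2Mr]: while [#|U| > 2Mr], regions have at most [#|U| / r] vertices.
    Each level multiplies the bound per vertex by [16ML], half for its own queries and half for the
    recursion; below the threshold all pairs are queried. *)
Lemma cost_general r L k (U : {set 'I_n}) : 0 < r -> n < 2 ^ L ->
    #|U| <= 2 * M * r * r ^ k ->
  cost e U <= #|U| * (r * M * (16 * M * L) ^ k.+1).
Proof.
move=> r0 nL; have M0 : 0 < M by rewrite expn_gt0.
have base (V : {set 'I_n}) k' : #|V| <= 2 * M * r ->
    cost e V <= #|V| * (r * M * (16 * M * L) ^ k'.+1).
  move=> leV; apply: leq_trans (cost_square e V) _.
  have [->//|/set0Pn[x _]] := eqVneq V set0; first by rewrite cards0.
  have L0 : 0 < L by rewrite lt0n; apply: contraL nL => /eqP->; case: (x); lia.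
  rewrite leq_mul2l (leq_trans leV) ?orbT //.
  have : (16 * M * L) ^ 1 <= (16 * M * L) ^ k'.+1 by rewrite leq_pexp2l //; nia.
  by rewrite expn1; move: (_ ^ k'.+1) => X; nia.
elim: k U => [|k IH] U leU; first by apply: base; rewrite expn0 muln1 in leU.
have [/base//|ltU] := leqP #|U| (2 * M * r).
have s1 : 1 < 2 * M * r by nia.
have [A [F [cA cF cost_le]]] := cost_step U s1 nL.
have cF' a : #|F a| * r <= #|U|.
  have := cF a; have -> : #|F a| * (2 * M * r) = 2 * M * (#|F a| * r) by lia.
  have le2 : M * (2 * M * r) + M * #|U| <= 2 * M * #|U| by nia.
  by move=> /leq_trans/(_ le2); rewrite leq_pmul2l // muln_gt0.
apply: leq_trans cost_le _; rewrite [_ ^ k.+2]expnS.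
have L0 : 0 < L.
  rewrite lt0n; apply: contraL nL => /eqP->.
  have := max_card (mem U); rewrite card_ord -leqNgt expn0; apply: leq_trans.
  exact: leq_ltn_trans ltU.
have X0 : 0 < 16 * M * L by move: M0 L0; move: (M) => m; nia.
have c0 : 0 < (16 * M * L) ^ k.+1 by rewrite expn_gt0 X0.
set c := r * M * (16 * M * L) ^ k.+1 in IH.
have -> : r * M * (16 * M * L * (16 * M * L) ^ k.+1) = 16 * M * L * c.
  by rewrite /c; lia.
have le_c : r * M <= c by rewrite /c leq_pmulr.
clearbody c.
have cost_F : \sum_(a in A) cost e (F a) <= 8 * M * L * #|U| * c.
  rewrite -(leq_pmul2r r0) big_distrl /=.
  apply: (@leq_trans (\sum_(a in A) #|U| * c)).
    apply: leq_sum => a _; apply: (@leq_trans (#|F a| * r * c)).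
      rewrite mulnAC leq_mul2r IH ?orbT // -(leq_pmul2r r0).
      by apply: leq_trans (cF' a) _; rewrite -mulnA -expnSr.
    by rewrite leq_mul2r cF' orbT.
  rewrite sum_nat_const; apply: leq_trans (leq_mul cA (leqnn _)) _.
  by move: (M) #|U| => m u; lia.
have cost_A : #|A| * M * #|U| <= 8 * M * L * #|U| * c.
  apply: (@leq_trans (4 * (2 * M * r) * L * M * #|U|)).
    by rewrite !leq_mul2r cA !orbT.
  have := leq_mul (leqnn (8 * M * L * #|U|)) le_c; move: (M) #|U| => m u; lia.
lia.
Qed.

End GeneralCost.

(** * Recursion through balanced separators *)

Section TreeSeparator.
Variables (n m : nat) (e : rel 'I_n) (te : rel 'I_m) (B : 'I_m -> {set 'I_n}).
Hypothesis (td : tree_decomposition e te B).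

Let te_sym : symmetric te.
Proof. by case: td => -[[]]. Qed.

Definition off t := [rel x y | [&& te x y, x != t & y != t]].
Definition branch t s := [set x | connect (off t) s x].
Definition strict_part t s :=
  [set v | (v \notin B t) && [exists x in branch t s, v \in B x]].

Lemma off_sym t : connect_sym (off t).
Proof.
apply: sym_connect_sym => x y /=.
by rewrite te_sym; congr (_ && _); rewrite andbC.
Qed.

Lemma neq_of_edge t s : te t s -> s != t.
Proof.
by case: td => -[[_ ir] _] _ _ _; apply: contraTneq => ->; rewrite ir.
Qed.

Lemma off_path t x p : x != t ->
  path (off t) x p = path te x p && (t \notin x :: p).
Proof.
elim: p x => [|y p IH] x xt; first by rewrite /= mem_seq1 eq_sym xt.
rewrite /= xt /= inE (eq_sym t x) (negbTE xt) /=.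
have [->|yt] := eqVneq y t; first by rewrite !inE eqxx !andbF.
by rewrite IH // andbT andbA.
Qed.

Lemma branch_neq t s x : s != t -> x \in branch t s -> x != t.
Proof.
move=> st; rewrite inE => /connectP[p]; rewrite off_path // => /andP[_ tp] ->.
by apply: contraNneq tp => <-; rewrite mem_last.
Qed.

(** Otherwise a simple path from [b] to [c] avoiding [a] closes to a cycle through [a]. *)
Lemma no_cycle a b c : te a b -> te a c -> connect (off a) b c -> b = c.
Proof.
move=> ab ac /connectP[p0 pp0 lp0].
case: (shortenP pp0) lp0 => p pp up _ lp.
apply/eqP; apply/negPn/negP => bc.
case: td => -[_ [_ acyclic]] _ _ _; apply: acyclic; exists (a :: b :: p).
rewrite off_path ?neq_of_edge // in pp; case/andP: pp => pp ap.
split; first by case: p lp {pp up ap} => [/= cb|//]; rewrite cb eqxx in bc.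
rewrite /ucycle /cycle rcons_path /= ab pp -lp te_sym ac /=.
by move: ap up => /= -> ->.
Qed.

(** A path from [t] to a common [x] off [s] leaves [t] by some [c]. As [c] and [s] are linked
    through [x] off [t], acyclicity forces [c = s], a contradiction. *)
Lemma branch_disjoint t s x : te t s -> x \in branch t s -> x \notin branch s t.
Proof.
move=> ts xts; apply/negP; rewrite inE => /connectP[p0 pp0 lp0].
have xt := branch_neq (neq_of_edge ts) xts.
case: (shortenP pp0) lp0 => -[|c p] pp up _ lp; first by rewrite lp eqxx in xt.
rewrite off_path in pp; last by rewrite eq_sym neq_of_edge.
case/andP: pp => /= /andP[tc pp]; rewrite in_cons negb_or => /andP[_ scp].
case/andP: up => tcp _.
have cx : connect (off t) c x.
  apply/connectP; exists p => //; rewrite off_path ?pp //.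
  by apply: contraNneq tcp => <-; rewrite mem_head.
move: xts; rewrite inE => sx.
have /(no_cycle ts tc) sc : connect (off t) s c.
  by apply: connect_trans sx _; rewrite off_sym.
by rewrite sc mem_head in scp.
Qed.

(** A path from [r] off [s] cannot meet [t], since [r] and [t] are distinct neighbours of [s]. This
    gives the descent to smaller sides. *)
Lemma branch_proper t s r : te t s -> te s r -> r != t ->
  branch s r \proper branch t s.
Proof.
move=> ts sr rt; apply/properP; split; last first.
  exists s; first by rewrite inE connect0.
  by apply/negP => /(branch_neq (neq_of_edge sr)); rewrite eqxx.
apply/subsetP => x; rewrite !inE => /connectP[p pp lp].
apply: (@connect_trans _ _ r); first by rewrite connect1 //= sr rt neq_of_edge.
apply/connectP; exists p => //; rewrite off_path //.
have pp' := pp; rewrite off_path ?neq_of_edge // in pp'; case/andP: pp' => -> _ /=.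
apply: contra rt => tp; apply/eqP/(no_cycle sr); first by rewrite te_sym.
move: tp pp; case/splitPl => p1 p2 <-; rewrite cat_path => /andP[pp1 _].
by apply/connectP; exists p1.
Qed.

(** The nodes whose bags contain [v] form a connected subtree missing [t]. *)
Lemma bag_branch v t s x y :
  v \notin B t -> v \in B x -> v \in B y -> x \in branch t s -> y \in branch t s.
Proof.
move=> vt vx vy; rewrite !inE => /connect_trans; apply.
case: td => _ _ _ /(_ v x y vx vy); apply: connect_sub => a b /and3P[ab va vb].
apply: connect1; rewrite /= ab /=.
by apply/andP; split; [move: va | move: vb]; apply: contraTneq => ->.
Qed.

Lemma strict_part_edge t s u v :
  e u v -> v \notin B t -> u \in strict_part t s -> v \in strict_part t s.
Proof.
move=> uv vt; rewrite !inE => /andP[ut /exists_inP[x xs ux]].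
rewrite vt; case: td => _ _ /(_ u v uv)[z /andP[uz vz]] _.
by apply/exists_inP; exists z => //; apply: bag_branch xs; [exact: ut | |].
Qed.

Lemma in_strict_part t v : v \notin B t -> exists2 s, te t s & v \in strict_part t s.
Proof.
move=> vt; case: td => -[_ [tc _]] /(_ v)[x vx] _ _.
have /connectP[p0 pp0 lp0] := tc t x.
case: (shortenP pp0) lp0 => -[|s p] pp up _ lp; first by rewrite lp /= (negbTE vt) in vx.
case/andP: pp => ts pp; exists s => //; rewrite inE vt /=.
apply/exists_inP; exists x => //; rewrite inE; apply/connectP; exists p => //.
rewrite off_path ?neq_of_edge //; apply/andP; split; first exact: pp.
by case/andP: up.
Qed.

Lemma strict_part_disjoint t s : te t s ->
  [disjoint strict_part t s & strict_part s t].
Proof.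
move=> ts; apply/pred0P => v /=; apply/negP; rewrite !inE.
case/andP=> /andP[vt /exists_inP[x xb vx]] /andP[vs /exists_inP[y yb vy]].
have := branch_disjoint ts (bag_branch vt vx vy xb).
by rewrite yb.
Qed.

Definition offB t := [rel u v | [&& e u v, u \notin B t & v \notin B t]].
Definition component (U : {set 'I_n}) t r :=
  [set u in U | (u \notin B t) && connect (offB t) r u].

(** No edge of [offB t] leaves a strict part. An empty component points to no neighbour, hence the
    alternative [set0]. *)
Lemma component_strict_part (U : {set 'I_n}) t r : symmetric e ->
  exists2 s, component U t r = set0 \/ te t s &
             component U t r \subset U :&: strict_part t s.
Proof.
move=> e_sym; have [->|/set0Pn[u]] := eqVneq (component U t r) set0.
  by exists t; [left | rewrite sub0set].
rewrite inE => /and3P[uU ut ru]; have [s ts us] := in_strict_part ut.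
exists s; first by right.
have offB_sym : connect_sym (offB t).
  apply: sym_connect_sym => x y /=.
  by rewrite e_sym; congr (_ && _); rewrite andbC.
have cl : closed (offB t) (mem (strict_part t s)).
  apply: intro_closed => // x y /and3P[xy _ yt]; exact: strict_part_edge.
apply/subsetP => v; rewrite inE => /and3P[vU vt rv]; rewrite in_setI vU /=.
have uv : connect (offB t) u v by apply: connect_trans rv; rewrite offB_sym.
by have := closed_connect cl uv; rewrite us => <-.
Qed.

(* Otherwise every node has a neighbour whose side contains most of [U]; a
   minimal such side leads to a contradiction. *)
Lemma balanced_separator (U : {set 'I_n}) : symmetric e -> U != set0 ->
  exists t, forall r, 2 * #|component U t r| <= #|U|.
Proof.
move=> e_sym Un0.
pose big_part (p : 'I_m * 'I_m) :=
  te p.1 p.2 && (#|U| < 2 * #|U :&: strict_part p.1 p.2|).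
have [/existsP[t /forallP ok]|] :=
    boolP [exists t, forall r, 2 * #|component U t r| <= #|U|].
  by exists t.
rewrite negb_exists => /forallP bad.
have next t : exists s, big_part (t, s).
  have := bad t; rewrite negb_forall => /existsP[r]; rewrite -ltnNge => lt.
  have [s [c0|ts] sub] := component_strict_part U t r e_sym.
    by move: lt; rewrite c0 cards0.
  exists s; rewrite /big_part /= ts; apply: leq_trans lt _.
  by rewrite leq_mul2l subset_leq_card.
case/set0Pn: Un0 => u _; case: td => _ /(_ u)[t0 _] _ _.
have [s0 big0] := next t0.
case: (arg_minnP (fun p => #|branch p.1 p.2|) big0) => -[t s] /andP[/= ts lt] min_ts.
have [r /andP[/= sr ltr]] := next s.
(* If [r] is not [t], the side [(s, r)] is smaller; if [r = t], two disjoint sets each hold more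
   than half of [U]. *)
have [rt|rt] := eqVneq r t; last first.
  have := min_ts (s, r); rewrite /big_part /= sr ltr => /(_ isT).
  by rewrite leqNgt (proper_card (branch_proper ts sr rt)).
have dis := strict_part_disjoint ts; rewrite rt in ltr.
have disU : (U :&: strict_part t s) :&: (U :&: strict_part s t) = set0.
  apply/setP => x; rewrite in_set0; apply/negbTE.
  by have := pred0P dis x; rewrite /= !in_setI; case: (x \in U) => //= ->.
have le : #|U :&: strict_part t s| + #|U :&: strict_part s t| <= #|U|.
  by rewrite -cardsUI disU cards0 addn0 subset_leq_card // subUset !subsetIl.
suff : 2 * #|U| < 2 * #|U| by rewrite ltnn.
apply: leq_trans (leq_mul (leqnn 2) le); rewrite mulnDr.
apply: (leq_trans _ (leq_add lt ltr)).
by rewrite [X in X < _]mul2n -addnn addSn ltnS addnS leqnSn.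
Qed.

End TreeSeparator.

(** * Query bound in terms of treewidth *)

Section TreewidthCost.
Variables (n : nat) (e : rel 'I_n).
Local Notation d := (sp_dist e).
Hypotheses (es : simple_graph e) (ec : connected_graph e).

Lemma geodesic_confirmed (X : {set 'I_n}) b u v :
    b \in X -> 1 < d u v -> d u b + d b v = d u v ->
  ~ (forall w, w \in ball1 e X -> d w u <= (d w v).+1 /\ d w v <= (d w u).+1).
Proof.
move=> bX; wlog le : u v / d b v <= d b u.
  move=> wl; have [/wl//|/ltnW le lt eq near] := leqP (d b v) (d b u).
  apply: (wl v u le) => [||w /near[]//]; rewrite (sp_dist_sym es ec v u) //.
  by rewrite addnC (sp_dist_sym es ec b u) (sp_dist_sym es ec v b).
move=> lt eq near; have bub := sp_dist_sym es ec u b.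
have [nb1 nb2] := near b (subsetP (sub_ball1 e X) b bX).
(* If [d b v = 0], then [d b u = d u v] is at least 2 and [b] itself is a witness. *)
have [bv|bv] := posnP (d b v); first by lia.
have [c [bc cv]] := sp_dist_split ec bv.
have [|cu _] := near c; first by rewrite inE; apply/exists_inP; exists b; rewrite ?bc.
(* Any shorter way from [c] to [u] would shorten the [u]-[v] geodesic, so [d c u > d b u] while
   [d c v < d b v]. *)
have := sp_dist_triangle ec c u v; have := sp_dist_sym es ec u c; lia.
Qed.

(** A shortest path avoiding [X] would connect [u] to [v] outside [X]; otherwise any of its vertices
    in [X] serves as [b]. *)
Lemma geodesic_through (X : {set 'I_n}) u v :
    ~~ [&& u \notin X, v \notin X &
        connect [rel x y | [&& e x y, x \notin X & y \notin X]] u v] ->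
  exists2 b, b \in X & d u b + d b v = d u v.
Proof.
have [p [pp lp sp]] := sp_dist_walk ec u v => nc.
have [/hasP[b bp bX]|/hasPn avoid] := boolP (has (mem X) (u :: p)).
  exists b => //; move: bp pp lp sp; case/splitPl => p1 p2 <-.
  rewrite cat_path last_cat => /andP[pp1 pp2] lp2.
  rewrite size_cat => sp.
  apply/eqP; rewrite eqn_leq sp_dist_triangle // andbT -sp leq_add //.
    exact: sp_dist_le pp1 erefl.
  exact: sp_dist_le pp2 lp2.
case/negP: nc; apply/and3P; split.
- by apply: avoid; rewrite mem_head.
- by apply: avoid; rewrite -lp mem_last.
apply/connectP; exists p => //.
elim: p u pp avoid {lp sp} => //= x p IH u /andP[ux pp] avoid.
rewrite ux !avoid ?inE ?eqxx ?orbT //=; apply: IH => // y yp.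
by apply: avoid; rewrite inE yp orbT.
Qed.

(** Induction on [j]: each level halves the sets and spends at most [w * (max_degree e).+1] queries
    per vertex. *)
Lemma cost_treewidth m (te : rel 'I_m) (B : 'I_m -> {set 'I_n}) w j
    (U : {set 'I_n}) :
    tree_decomposition e te B -> (forall t, #|B t| <= w) -> #|U| < 2 ^ j ->
  cost e U <= #|U| * (j * (w * (max_degree e).+1)).
Proof.
move=> td wB; elim: j U => [|j IH] U ltU.
  by apply: leq_trans (cost_square e U) _; move: ltU; rewrite ltnS leqn0 => /eqP->.
have [->|Un0] := eqVneq U set0.
  by apply: leq_trans (cost_square e _) _; rewrite cards0.
have [t sep] := balanced_separator td (proj1 es) Un0.
have offB_sym : connect_sym (offB e B t).
  apply: sym_connect_sym => x y /=.
  by rewrite (proj1 es); congr (_ && _); rewrite andbC.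
(* Indexing components by their roots makes them disjoint, so their sizes sum to at most [#|U|]. *)
pose F r := [set u in U | (u \notin B t) && (root (offB e B t) u == r)].
have half r : #|F r| < 2 ^ j.
  have : #|F r| <= #|component e B U t r|.
    apply/subset_leq_card/subsetP => u; rewrite !inE => /and3P[-> -> /eqP<-].
    by rewrite offB_sym connect_root.
  by have := sep r; rewrite expnS in ltU; lia.
apply: leq_trans (cost_split (P := predT) (F := F) (X := ball1 e (B t)) _) _.
  move=> u v uU vU lt near.
  have [/and3P[ut vt uv]|] := boolP [&& u \notin B t, v \notin B t &
      connect (offB e B t) u v]; last first.
    case/geodesic_through => b bX eq.
    by case: (geodesic_confirmed bX lt eq).
  exists (root (offB e B t) u) => //; rewrite !inE uU vU ut vt eqxx /=.
  by rewrite eq_sym root_connect.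
have sumF : \sum_r #|F r| <= #|U|.
  rewrite -sum1_card [X in _ <= X](partition_big (root (offB e B t)) predT) //=.
  apply: leq_sum => r _; rewrite sum1dep_card; apply: subset_leq_card.
  by apply/subsetP => u; rewrite !inE => /and3P[-> _ ->].
set K := w * _.
have cX : #|ball1 e (B t)| <= K.
  by apply: leq_trans (card_ball1 es ec _) _; rewrite leq_mul2r wB orbT.
have cF : \sum_r cost e (F r) <= #|U| * (j * K).
  apply: leq_trans (leq_mul sumF (leqnn _)); rewrite big_distrl /=.
  by apply: leq_sum => r _; apply: IH.
apply: leq_trans (leq_add (leq_mul cX (leqnn _)) cF) _.
by rewrite mulSn mulnDr (mulnC K).
Qed.

End TreewidthCost.

(** * The algorithm *)

Section Algorithm.
Variables (n : nat).
Implicit Types (e : rel 'I_n) (o : 'I_n -> 'I_n -> nat) (l : seq ('I_n * 'I_n)).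

Fixpoint check e l : qtree 'I_n :=
  if l is p :: l' then
    Ask p.1 p.2
      (fun k => if k == sp_dist e p.1 p.2 then check e l' else Leaf _ false)
  else Leaf _ true.

Lemma check_accept e o l :
  (run o (check e l)).1 = all (fun p => o p.1 p.2 == sp_dist e p.1 p.2) l.
Proof. by elim: l => //= p l <-; case: ifP. Qed.

Lemma check_queries e o l : (run o (check e l)).2 <= size l.
Proof. by elim: l => //= p l IH; case: ifP => _ //=; rewrite ltnS. Qed.

Definition edge_pairs e := [set p : 'I_n * 'I_n | e p.1 p.2].

Definition verify e := check e (enum (edge_pairs e) ++ enum (opt_cover e setT)).

Lemma eq_sp_dist e1 e2 : e1 =2 e2 -> sp_dist e1 =2 sp_dist e2.
Proof.
move=> eq u v; apply: eq_find => k; apply: eq_existsb => p.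
by rewrite (eq_path eq).
Qed.

Lemma verify_correct eh e :
    simple_graph eh -> connected_graph eh -> simple_graph e -> connected_graph e ->
  (run (sp_dist e) (verify eh)).1 = true <-> eh =2 e.
Proof.
move=> hs hc es ec; rewrite check_accept; split=> [|eq]; last first.
  by apply/allP => p _; rewrite (eq_sp_dist eq).
move/allP=> ok.
have sub u v : eh u v -> e u v.
  move=> uv; rewrite (sp_dist_edge es ec).
  have /(ok (u, v))/eqP/= -> : (u, v) \in enum (edge_pairs eh) ++ enum (opt_cover eh setT).
    by rewrite mem_cat mem_enum inE uv.
  by rewrite -(sp_dist_edge hs hc).
have dist_le u v : sp_dist e u v <= sp_dist eh u v.
  have [p [pp lp <-]] := sp_dist_walk hc u v.
  by apply: sp_dist_le lp; apply: sub_path pp.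
move=> u v; apply/idP/idP; first exact: sub.
apply: contraTT => nuv; apply/negP => uv.
have duv : 1 < sp_dist eh u v.
  move: nuv; rewrite (sp_dist_edge hs hc).
  case dd: (sp_dist eh u v) => [|[|//]] // _.
  have := sp_dist_walk hc u v; rewrite dd => -[[|? ?] [] //= _ eq _].
  by move: uv; rewrite eq (proj2 es).
have /coversP/(_ u v (in_setT _) (in_setT _) duv)[[a b] pT] := covers_opt eh setT.
have /ok/eqP /= dab : (a, b) \in enum (edge_pairs eh) ++ enum (opt_cover eh setT).
  by rewrite mem_cat orbC mem_enum pT.
(* An edge [xy] of [e] yields a walk from [a] to [b] through it, whose length bounds the answer
   [sp_dist eh a b] from above. *)
have near x y : e x y -> ~~ (sp_dist eh a x + sp_dist eh y b + 1 < sp_dist eh a b).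
  rewrite (sp_dist_edge es ec) -leqNgt -dab => /eqP xy.
  have := sp_dist_triangle ec x a b; have := sp_dist_triangle ec y x b.
  have := dist_le a x; have := dist_le y b; lia.
by rewrite /confirms; apply/negP/norP; split; apply: near; rewrite // (proj1 es).
Qed.

Lemma card_edge_pairs e : #|edge_pairs e| <= n * max_degree e.
Proof.
have -> : #|edge_pairs e| = \sum_(u : 'I_n) \sum_(v : 'I_n | e u v) 1.
  by rewrite -sum1dep_card pair_big_dep.
rewrite -[X in X * _]card_ord -sum_nat_const; apply: leq_sum => u _.
by rewrite sum1dep_card (leq_bigmax (F := fun v => #|[set u | e v u]|)).
Qed.

Lemma verify_queries e o :
  (run o (verify e)).2 <= n * max_degree e + cost e setT.
Proof.
apply: leq_trans (check_queries _ _ _) _.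
by rewrite size_cat -!cardE leq_add // card_edge_pairs.
Qed.

Variable e : rel 'I_n.
Hypotheses (es : simple_graph e) (ec : connected_graph e) (n1 : 1 < n).

Lemma connected_edge : exists u v, e u v.
Proof.
pose x : 'I_n := Ordinal (ltnW n1); pose y : 'I_n := Ordinal n1.
by have /connectP[[|v p] //= /andP[xv _] _] := ec x y; exists x, v.
Qed.

Lemma max_degree_gt0 : 0 < max_degree e.
Proof.
have [u [v uv]] := connected_edge.
apply: leq_trans (leq_bigmax (F := fun v => #|[set u | e v u]|) u).
by rewrite card_gt0; apply/set0Pn; exists v; rewrite inE.
Qed.

Lemma max_degree_le : max_degree e <= n.
Proof.
by apply/bigmax_leqP => u _; rewrite -[X in _ <= X]card_ord max_card.
Qed.

(** Serves when the square root in the exponent exceeds 1. *)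
Lemma verify_queries_square o : (run o (verify e)).2 <= n ^ 3.
Proof.
apply: leq_trans (verify_queries e o) _.
have := cost_square e setT; rewrite cardsT card_ord; have := max_degree_le.
by rewrite !expnS expn0; nia.
Qed.

Lemma verify_queries_general o r L k : 0 < r -> n < 2 ^ L -> n <= r ^ k ->
  (run o (verify e)).2 <= n * r * (64 * max_degree e ^ 2 * L) ^ k.+2.
Proof.
move=> r0 nL nr; apply: leq_trans (verify_queries e o) _.
have D0 := max_degree_gt0.
have := cost_general es ec (U := setT) (k := k) r0 nL; rewrite cardsT card_ord.
have L0 : 0 < L by rewrite lt0n; apply: contraL nL => /eqP->; lia.
move: (max_degree e) D0 => D D0 /= cost_le.
have {}cost_le := cost_le _; move: cost_le.
set M := D.+1 ^ 2.
have DM : D <= M by rewrite /M; lia.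
have MD : M <= 4 * D ^ 2 by rewrite /M; nia.
clearbody M => cost_le.
have {}cost_le : cost e setT <= n * (r * M * (16 * M * L) ^ k.+1).
  by apply: cost_le; apply: leq_trans nr _; apply: leq_pmull; nia.
have c0 : 0 < (16 * M * L) ^ k.+1 by rewrite expn_gt0; apply/orP; left; nia.
(* One more factor [16 * M * L] pays for [M] and the [n * D] edge queries; [M <= 4 * D ^ 2] then
   turns 16 into 64. *)
apply: (@leq_trans (n * r * (16 * M * L) ^ k.+2)).
  rewrite [_ ^ k.+2]expnS; move: (_ ^ k.+1) c0 cost_le => c c0 cost_le.
  have h1 : D * 1 <= M * (r * c) by apply: leq_mul; nia.
  have h2 : n * (D * 1) <= n * (M * (r * c)) by rewrite leq_mul2l h1 orbT.
  have h3 : 2 * (n * (M * (r * c))) <= 16 * L * (n * (M * (r * c))).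
    by rewrite leq_mul2r; apply/orP; right; lia.
  by move: cost_le h2 h3; move: (cost _ _) => C; lia.
rewrite leq_mul2l leq_exp2r //; apply/orP; right.
by rewrite leq_mul2r; apply/orP; right; lia.
Qed.

Lemma verify_queries_treewidth o tw j : has_treewidth e tw -> n < 2 ^ j ->
  0 < tw /\ (run o (verify e)).2 <= 5 * n * j * tw * max_degree e.
Proof.
move=> [[m [te [B [td width]]]] _] nj.
have wB t : #|B t| <= tw.+1.
  rewrite -width; apply: leq_trans (leqSpred _).
  exact: (leq_bigmax (F := fun t => #|B t|)).
have tw0 : 0 < tw.
  have [u [v uv]] := connected_edge.
  case: td => _ _ /(_ u v uv)[t /andP[ut vt]] _.
  rewrite -ltnS; apply: leq_trans (wB t); apply: (@leq_trans #|[set u; v]|).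
    rewrite cards2; case: eqVneq uv => // ->; by rewrite (proj2 es).
  by rewrite subset_leq_card // subUset !sub1set ut vt.
split=> //; apply: leq_trans (verify_queries e o) _.
have := cost_treewidth es ec (U := setT) td wB; rewrite cardsT card_ord => /(_ _ nj).
have := max_degree_gt0; have j0 : 0 < j.
  by rewrite lt0n; apply: contraL nj => /eqP->; rewrite -leqNgt expn0; lia.
move: (max_degree e) (cost _ _) => D C D0 cost_le.
(* The factor 5 is this 4 plus 1 for the edge queries. *)
have h : tw.+1 * D.+1 <= 4 * (tw * D) by nia.
have h1 : n * (j * (tw.+1 * D.+1)) <= n * (j * (4 * (tw * D))).
  by rewrite !leq_mul2l h !orbT.
have h2 : n * D * 1 <= n * D * (j * tw) by rewrite leq_mul2l; apply/orP; right; nia.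
lia.
Qed.

End Algorithm.

(** * Real bounds *)

Open Scope R_scope.

Lemma INR_muln (a b : nat) : INR (a * b)%N = INR a * INR b.
Proof. by rewrite -multE mult_INR. Qed.

Lemma INR_expn (a k : nat) : INR (a ^ k)%N = INR a ^ k.
Proof. by elim: k => [|k IH] //; rewrite expnS INR_muln IH. Qed.

Lemma INR_leq (a b : nat) : (a <= b)%N -> INR a <= INR b.
Proof. by move/leP/le_INR. Qed.

Lemma exp_mono x y : x <= y -> exp x <= exp y.
Proof. by case=> [/exp_increasing|->]; lra. Qed.

Lemma ln_mono x y : 0 < x -> x <= y -> ln x <= ln y.
Proof. by move=> x0 [/(ln_increasing _ _ x0)|->]; lra. Qed.

Lemma exp_pow x (k : nat) : exp x ^ k = exp (INR k * x).
Proof.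
elim: k => [|k IH]; first by rewrite Rmult_0_l exp_0.
by rewrite S_INR /= IH -exp_plus; congr exp; ring.
Qed.

Lemma exp_1_ge2 : 2 <= exp 1.
Proof. by have := exp_ineq1_le 1; lra. Qed.

Lemma exp_ln_ge1 (a : nat) : (0 < a)%N -> exp (ln (INR a)) = INR a /\ 0 <= ln (INR a).
Proof.
move/INR_leq => /= a1; split; first by rewrite exp_ln //; lra.
by rewrite -ln_1; apply: ln_mono; lra.
Qed.

Lemma nat_ceil x : 0 < x -> exists k : nat, x <= INR k <= x + 1.
Proof.
move=> x0; have [lt le] := archimed x.
have up0 : (0 <= up x)%Z by apply: le_IZR; lra.
by exists (Z.to_nat (up x)); rewrite INR_IZR_INZ Z2Nat.id //; lra.
Qed.

(** The threshold 27 is [3 ^ 3], from [exp 1 <= 3]. *)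
Lemma ln_INR_ge3 (n : nat) : (27 <= n)%N -> 3 <= ln (INR n) /\ 1 <= ln (ln (INR n)).
Proof.
move/INR_leq => n27.
have e3 : exp 3 <= 27.
  have -> : 3 = INR 3 * 1 by rewrite /=; ring.
  rewrite -exp_pow; have := exp_le_3; have := exp_pos 1.
  by move: (exp 1) => t t0 t3; rewrite /=; nra.
have l3 : 3 <= ln (INR n).
  rewrite -(ln_exp 3); apply: ln_mono; first exact: exp_pos.
  by move: n27; rewrite INR_IZR_INZ /=; lra.
split=> //; rewrite -(ln_exp 1); apply: ln_mono; first exact: exp_pos.
by have := exp_le_3; lra.
Qed.

(** The witness is at most [log2 n + 1 <= 2 ln n + 1], as [ln 2 > 1/2]. *)
Lemma log2_bound (n : nat) : (27 <= n)%N ->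
  exists2 L : nat, (n < 2 ^ L)%N & INR L <= 3 * ln (INR n).
Proof.
move=> n27; have [l3 _] := ln_INR_ge3 n27.
exists (trunc_log 2 n).+1; first by rewrite trunc_log_ltn.
have n0 : (0 < n)%N by apply: leq_trans n27.
have := INR_leq (trunc_logP (erefl : 1 < 2)%N n0).
rewrite INR_expn => le; rewrite S_INR; set t := trunc_log 2 n in le *.
have : ln (INR 2 ^ t) <= ln (INR n) by apply: ln_mono le; apply: pow_lt; rewrite /=; lra.
rewrite ln_pow; last by rewrite /=; lra.
have -> : INR 2 = 2 by [].
have := Rmult_le_compat_l _ _ _ (pos_INR t) (Rlt_le _ _ ln_lt_2); lra.
Qed.

(** With [y] the square root, take [k] about [1/y] and [r] about [n^y]. *)
Lemma subpolynomial_bound (n q D L : nat) :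
    (27 <= n)%N -> (0 < D)%N -> INR L <= 3 * ln (INR n) ->
    (q <= n ^ 3)%N ->
    (forall r k : nat, (0 < r)%N -> (n <= r ^ k)%N ->
       (q <= n * r * (64 * D ^ 2 * L) ^ k.+2)%N) ->
  INR q <= Rpower (INR n)
    (1 + 40 * sqrt ((ln (ln (INR n)) + ln (INR D)) / ln (INR n))).
Proof.
move=> n27 D0 leL cube general; have [x3 lx1] := ln_INR_ge3 n27.
have [nE _] := exp_ln_ge1 (leq_trans (isT : (0 < 27)%N) n27).
have [DE l0] := exp_ln_ge1 D0; rewrite /Rpower.
set x := ln (INR n) in x3 lx1 leL nE *; set l := ln (INR D) in DE l0 *.
have lxE : exp (ln x) = x by apply: exp_ln; lra.
set lam := ln x + l; set y := sqrt _.
have lam1 : 1 <= lam by rewrite /lam; lra.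
have y0 : 0 < y by apply: sqrt_lt_R0; apply: Rdiv_lt_0_compat; lra.
have yy : y * y * x = lam.
  rewrite /y sqrt_sqrt; first by field; lra.
  by apply: Rlt_le; apply: Rdiv_lt_0_compat; lra.
have [y1|y1] := Rle_lt_dec y 1; last first.
  apply: Rle_trans (INR_leq cube) _; rewrite INR_expn -nE exp_pow.
  by apply: exp_mono; rewrite [INR 3]/=; nra.
have [k [k1 k2]] := nat_ceil (Rinv_0_lt_compat _ y0).
have [r [r1 r2]] := nat_ceil (exp_pos (y * x)).
have ky : 1 <= INR k * y.
  by have := Rinv_l y (Rgt_not_eq _ _ y0); nra.
have ky2 : INR k * y <= 1 + y.
  by have := Rinv_l y (Rgt_not_eq _ _ y0); nra.
have yx : 1 <= y * x by nra.
have r0 : (0 < r)%N.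
  by apply/ltP/INR_lt; have := exp_pos (y * x); rewrite /=; lra.
have nrk : (n <= r ^ k)%N.
  apply/leP/INR_le; rewrite INR_expn -nE; apply: (Rle_trans _ (exp (y * x) ^ k)).
    by rewrite exp_pow; apply: exp_mono; nra.
  by apply: pow_incr; split=> //; apply: Rlt_le; apply: exp_pos.
apply: Rle_trans (INR_leq (general r k r0 nrk)) _.
rewrite 2!INR_muln INR_expn.
have rle : INR r <= exp (1 + y * x).
  rewrite exp_plus; have := exp_1_ge2; have := exp_ineq1_le (y * x); nra.
(* [64 * 3 <= exp 8] and [1 <= ln x] let the constants be absorbed into [9 * lam]. *)
have Xle : INR (64 * D ^ 2 * L) <= exp (9 * lam).
  rewrite 2!INR_muln INR_expn -DE.
  have e8 : 256 <= exp 8.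
    have -> : 8 = INR 8 * 1 by rewrite /=; ring.
    rewrite -exp_pow; have -> : 256 = 2 ^ 8 by ring.
    by apply: pow_incr; have := exp_1_ge2; lra.
  have c64 : INR 64 = 64 by rewrite INR_IZR_INZ.
  have dpos : 0 <= exp l ^ 2 by apply: pow_le; apply: Rlt_le; apply: exp_pos.
  apply: (Rle_trans _ (64 * exp l ^ 2 * (3 * x))).
    by rewrite c64; apply: Rmult_le_compat_l; nra.
  apply: (Rle_trans _ (exp 8 * exp l ^ 2 * exp (ln x))).
    rewrite lxE; have : 0 <= exp l ^ 2 * x by apply: Rmult_le_pos; lra.
    by move: (exp l ^ 2) dpos (exp 8) e8 => a a0 b b0; nra.
  rewrite exp_pow -!exp_plus; apply: exp_mono; rewrite [INR 2]/= /lam; lra.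
apply: (Rle_trans _ (exp x * exp (1 + y * x) * exp (9 * lam) ^ k.+2)).
  rewrite nE; apply: Rmult_le_compat.
  - by apply: Rmult_le_pos; apply: pos_INR.
  - by apply: pow_le; apply: pos_INR.
  - by apply: Rmult_le_compat_l; [apply: pos_INR | lra].
  - by apply: pow_incr; split; [apply: pos_INR | lra].
(* As [lam = y * (y * x)], [INR k * y <= 2] and [1 <= y * x], the excess over [x] is at most
   [(2 + 18 + 18) * (y * x)]. *)
rewrite exp_pow -!exp_plus; apply: exp_mono; rewrite !S_INR -yy.
have h : (INR k * y) * (y * x) <= 2 * (y * x) by apply: Rmult_le_compat_r; lra.
have h2 : y * (y * x) <= y * x by nra.
nra.
Qed.

Theorem theorem1 :
  exists A : forall n : nat, rel 'I_n -> qtree 'I_n,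
    (* correctness: for every connected given graph Ĝ and every unknown
       connected G, the algorithm accepts iff G = Ĝ *)
    (forall (n : nat) (eh e : rel 'I_n),
        simple_graph eh -> connected_graph eh ->
        simple_graph e -> connected_graph e ->
        ((run (sp_dist e) (A n eh)).1 = true <-> eh =2 e))
    /\
    (* query complexity n^{1 + O(sqrt((loglog n + log Δ)/log n))} *)
    (exists (C : R) (n0 : nat), forall (n : nat), (n0 <= n)%N ->
       forall eh e : rel 'I_n,
        simple_graph eh -> connected_graph eh ->
        simple_graph e -> connected_graph e ->
        INR (run (sp_dist e) (A n eh)).2 <=
          Rpower (INR n)
            (1 + C * sqrt ((ln (ln (INR n)) + ln (INR (max_degree eh)))
                           / ln (INR n))))
    /\
    (* query complexity O(Δ (Δ + tw log n) n log^2 n) *)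
    (exists (C : R) (n0 : nat), forall (n : nat), (n0 <= n)%N ->
       forall (eh e : rel 'I_n) (tw : nat),
        simple_graph eh -> connected_graph eh -> has_treewidth eh tw ->
        simple_graph e -> connected_graph e ->
        INR (run (sp_dist e) (A n eh)).2 <=
          C * INR (max_degree eh)
            * (INR (max_degree eh) + INR tw * ln (INR n))
            * INR n * (ln (INR n)) ^ 2).
Proof.
exists verify; split; [exact: verify_correct | split].
- exists 40, 27%N => n n27 eh e hs hc es ec.
  have n1 : (1 < n)%N by apply: leq_trans n27.
  have [L nL leL] := log2_bound n27.
  apply: (subpolynomial_bound n27 (max_degree_gt0 hc n1) leL).
    exact: verify_queries_square.
  by move=> r k r0; apply: verify_queries_general.
(* 15 is [5 * 3], from [j <= 3 * ln n]; the summand with [tw] already dominates the query count. *)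
- exists 15, 27%N => n n27 eh e tw hs hc htw es ec.
  have n1 : (1 < n)%N by apply: leq_trans n27.
  have [j nj lej] := log2_bound n27; have [x3 _] := ln_INR_ge3 n27.
  have [tw0 le] := verify_queries_treewidth hs hc n1 (sp_dist e) htw nj.
  apply: Rle_trans (INR_leq le) _; rewrite !INR_muln.
  move: (INR_leq (max_degree_gt0 hc n1)) (INR_leq tw0) x3 lej (pos_INR n) (pos_INR j).
  move: (ln (INR n)) => x.
  move: (INR (max_degree eh)) (INR tw) (INR n) (INR j) => D w N J /=.
  move=> D1 w1 x3 lej N0 J0.
  have P0 : 0 <= N * w * D by apply: Rmult_le_pos; [apply: Rmult_le_pos |]; lra.
  have h1 : N * w * D * J <= N * w * D * (3 * x) by apply: Rmult_le_compat_l; lra.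
  have h2 : N * w * D * x * 1 <= N * w * D * x * x ^ 2.
    by apply: Rmult_le_compat_l; [apply: Rmult_le_pos => //; lra | rewrite /=; nra].
  have h3 : 0 <= D * D * N * x ^ 2
    by apply: Rmult_le_pos; [apply: Rmult_le_pos => //; nra | rewrite /=; nra].
  lra.
Qed.
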